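(* Let $\mathbf s_0,\mathbf s_4\in\mathbb S^2$ with $\mathbf s_0\ne\mathbf s_4$ and $\mathbf s_2\in\mathcal C(\mathbf s_0,\mathbf s_4)$ be given. Then there is a one-parameter family of pairs of spherical points $\mathbf s_1\in\mathcal C(\mathbf s_0,\mathbf s_2)$ and $\mathbf s_3\in\mathcal C(\mathbf s_4,\mathbf s_2)$ such that $\mathbf s_0,\mathbf s_1,\mathbf s_2,\mathbf s_3,\mathbf s_4$ are the spherical control points of an RRMF5-I curve. Moreover, every point of $\mathcal C(\mathbf s_0,\mathbf s_2)$ and every point of $\mathcal C(\mathbf s_4,\mathbf s_2)$ occurs in precisely one such pair, and the resulting bijection $\mathbf s_1\leftrightarrow\mathbf s_3$ between the two great circles $\mathcal C(\mathbf s_0,\mathbf s_2)$ and $\mathcal C(\mathbf s_4,\mathbf s_2)$ is smooth and preserves the orientation.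
   Context: Let $\mathbb H$ be the quaternions, with pure vector quaternions identified with $\mathbb R^3$; $\mathcal A^*$ denotes conjugation and $\mathrm{vect}(\mathcal A)$ the vector part. Fix a unit pure vector $\mathbf i$. Let $B_i^n(t)=\binom ni t^i(1-t)^{n-i}$. An RRMF5-I curve (quintic curve of class I with rational rotation-minimizing frame) is a polynomial curve $\mathbf r:[0,1]\to\mathbb R^3$ whose hodograph is $\mathbf h(t)=\mathbf r'(t)=\mathcal A(t)\,\mathbf i\,\mathcal A^*(t)$, where $\mathcal A(t)=\mathcal A_0B_0^2(t)+\mathcal A_1B_1^2(t)+\mathcal A_2B_2^2(t)$ is a quaternion polynomial (the pre-image) with $\mathcal A_0,\mathcal A_1,\mathcal A_2\in\mathbb H$ satisfying $$\mathcal A_1\,\mathbf i\,\mathcal A_1^*=\mathrm{vect}(\mathcal A_2\,\mathbf i\,\mathcal A_0^* ).$$ The hodograph control points $\mathbf h_0,\ldots,\mathbf h_4\in\mathbb R^3$ are the Bernstein coefficients in $\mathbf h(t)=\sum_{i=0}^4\mathbf h_iB_i^4(t)$. When $\mathbf h_i\neq\mathbf 0$ for all $i=0,\ldots,4$, the spherical control points are $\mathbf s_i=\mathbf h_i/|\mathbf h_i|\in\mathbb S^2$. For distinct $\mathbf v,\mathbf w\in\mathbb S^2$, $\mathcal C(\mathbf v,\mathbf w)$ denotes the great circle of points of $\mathbb S^2$ having the same angular distance from $\mathbf v$ and $\mathbf w$, i.e. $\{\mathbf x\in\mathbb S^2:\mathbf x\cdot\mathbf v=\mathbf x\cdot\mathbf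 w\}$. If $\mathbf v\times\mathbf w\neq\mathbf 0$, it is oriented (depending on the order of the arguments) so that its tangent direction at the point $(\mathbf v+\mathbf w)/|\mathbf v+\mathbf w|$ is the unit vector $-(\mathbf v\times\mathbf w)/|\mathbf v\times\mathbf w|$. (If $\mathbf s_0\neq\mathbf s_4$ and $\mathbf s_2\in\mathcal C(\mathbf s_0,\mathbf s_4)$, then $\mathbf s_0\times\mathbf s_2\ne\mathbf 0$ and $\mathbf s_4\times\mathbf s_2\neq\mathbf 0$, so both circles in the statement are oriented.) *)

(* Defs.v *)
From mathcomp Require Import all_boot all_order all_algebra.
From mathcomp Require Import all_classical all_reals all_analysis.

Set Implicit Arguments.
Unset Strict Implicit.
Unset Printing Implicit Defensive.

Import Order.TTheory GRing.Theory Num.Theory.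
Import numFieldNormedType.Exports.

Local Open Scope classical_set_scope.
Local Open Scope ring_scope.

Section Euclidean_space.
Variable R : realType.
Implicit Types u v w x : 'rV[R]_3.

Definition dotv u v : R := \sum_k u 0 k * v 0 k.

(* The norm `|u| that MathComp puts on 'rV[R]_3 is the sup norm; lengths of
   vectors are measured with [enorm] instead. *)
Definition enorm u : R := Num.sqrt (dotv u u).

Definition normalize u : 'rV[R]_3 := (enorm u)^-1 *: u.

Definition row3 (a b c : R) : 'rV[R]_3 := \row_(k < 3) [:: a; b; c]`_k.

Definition crossv u v : 'rV[R]_3 :=
  let u_ k := u 0 (inord k) in
  let v_ k := v 0 (inord k) in
  row3 (u_ 1%N * v_ 2%N - u_ 2%N * v_ 1%N)
       (u_ 2%N * v_ 0%N - u_ 0%N * v_ 2%N)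
       (u_ 0%N * v_ 1%N - u_ 1%N * v_ 0%N).

Definition sphere2 : set 'rV[R]_3 := [set x | enorm x = 1].

Definition great_circle v w : set 'rV[R]_3 :=
  [set x | sphere2 x /\ dotv x v = dotv x w].

(* [circle_base v w] is a point of [great_circle v w], and [circle_dir v w] is
   the unit tangent vector which orients the circle at that point.  They are
   meaningful when v and w are points of the sphere with [crossv v w != 0]. *)
Definition circle_base v w : 'rV[R]_3 := normalize (v + w).
Definition circle_dir v w : 'rV[R]_3 := - normalize (crossv v w).

(* Positively oriented parametrization of [great_circle v w] by arc length. *)
Definition circle_param v w (t : R) : 'rV[R]_3 :=
  cos t *: circle_base v w + sin t *: circle_dir v w.

(* Positive unit tangent vector at the point x of the circle: the rotation axis
   [crossv base dir] turns [circle_base] towards [circle_dir]. *)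
Definition circle_tangent v w x : 'rV[R]_3 :=
  crossv (crossv (circle_base v w) (circle_dir v w)) x.

Definition smooth_curve (f : R -> 'rV[R]_3) : Prop :=
  forall (n : nat) (t : R), derivable (derive1n n f) t 1.

(* C^oo maps on an oriented great circle, for its manifold structure: the
   charts are the local inverses of [circle_param]. *)
Definition smooth_on_circle v w (f : 'rV[R]_3 -> 'rV[R]_3) : Prop :=
  smooth_curve (f \o circle_param v w).

(* The differential of f sends positive tangent vectors of the circle (v, w)
   to positive tangent vectors of the circle (v', w'). *)
Definition orientation_preserving v w v' w' (f : 'rV[R]_3 -> 'rV[R]_3) : Prop :=
  forall t : R, exists2 c : R, 0 < c &
    derive1 (f \o circle_param v w) t
    = c *: circle_tangent v' w' (f (circle_param v w t)).

End Euclidean_space.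

(* A quaternion is a pair (scalar part, vector part). *)
Definition quaternion (R : realType) : Type := (R * 'rV[R]_3)%type.

Section Quaternions.
Variable R : realType.
Implicit Types A B : quaternion R.

Definition quat_mul A B : quaternion R :=
  (A.1 * B.1 - dotv A.2 B.2, A.1 *: B.2 + B.1 *: A.2 + crossv A.2 B.2).

Definition quat_conj A : quaternion R := (A.1, - A.2).

Definition vect A : 'rV[R]_3 := A.2.

Definition pure (u : 'rV[R]_3) : quaternion R := (0, u).

End Quaternions.

Section RRMF_curves.
Variable R : realType.

Definition bernstein (n i : nat) (t : R) : R :=
  'C(n, i)%:R * t ^+ i * (1 - t) ^+ (n - i).

Definition preimage_poly (A0 A1 A2 : quaternion R) (t : R) : quaternion R :=
  bernstein 2 0 t *: A0 + bernstein 2 1 t *: A1 + bernstein 2 2 t *: A2.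

(* A polynomial curve is given by its three coordinate polynomials. *)
Definition hodograph (r : 'rV[{poly R}]_3) (t : R) : 'rV[R]_3 :=
  \row_k (deriv (r 0 k)).[t].

Definition RRMF5_I (e : 'rV[R]_3) (r : 'rV[{poly R}]_3) : Prop :=
  exists A0 A1 A2 : quaternion R,
    quat_mul (quat_mul A1 (pure e)) (quat_conj A1)
      = pure (vect (quat_mul (quat_mul A2 (pure e)) (quat_conj A0)))
    /\ forall t : R, 0 <= t <= 1 ->
         let A := preimage_poly A0 A1 A2 t in
         pure (hodograph r t) = quat_mul (quat_mul A (pure e)) (quat_conj A).

Definition hodograph_control_points
    (r : 'rV[{poly R}]_3) (h : 'I_5 -> 'rV[R]_3) : Prop :=
  forall t : R, 0 <= t <= 1 ->
    hodograph r t = \sum_(i < 5) bernstein 4 i t *: h i.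

Definition spherical_control_points
    (r : 'rV[{poly R}]_3) (s : 5.-tuple 'rV[R]_3) : Prop :=
  exists h : 'I_5 -> 'rV[R]_3,
    [/\ hodograph_control_points r h,
        forall i, h i != 0
      & forall i, tnth s i = normalize (h i)].

Definition RRMF5_I_pairs (e s0 s2 s4 : 'rV[R]_3) :
    set ('rV[R]_3 * 'rV[R]_3) :=
  [set p | [/\ great_circle s0 s2 p.1, great_circle s4 s2 p.2
    & exists r : 'rV[{poly R}]_3, RRMF5_I e r /\
        spherical_control_points r [tuple s0; p.1; s2; p.2; s4]]].

End RRMF_curves.

(* Main.v *)
From HB Require Import structures.
Require Import Defs.
From mathcomp Require Import all_boot all_order all_algebra.
From mathcomp Require Import all_classical all_reals all_analysis.
From mathcomp Require Import ring lra.

(** Write A0, A1, A2 for the coefficients of a pre-image, identify a vector u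
    with the pure quaternion [pure u] (so a unit vector is a square root of -1)
    and set X = A0 e A1*, Y = A2 e A1*, Z = A2 e A0*.  The hodograph control
    points of the curve are A0 e A0*, vect X, vect Z / 3 + 2 A1 e A1* / 3,
    vect Y and A2 e A2*; the defining condition of the class says that the third
    one is A1 e A1* = vect Z.  If the spherical control points are s0, ..., s4,
    then s0, s2, s4 are the images of e under A0, A1, A2, which gives
      s0 X = X s2,     s4 Y = Y s2,     s4 Z = Z s0.

    For unit vectors u <> w the quaternions X with u X = X w form a plane, and
    X |-> vect X maps that plane bijectively onto the plane of the vectors
    having equal products with u and with w; the inverse is [lift_quat u w]
    ([lift_quat_intertwines], [lift_quat_unique]).  Hence Z is a positive
    multiple of the constant lift of s2, X is a positive multiple of the lift of
    s1, and Y is determined by X: up to a positive factor, Y = Q X with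
    Q = - Z s0 ([transfer_quat]).  So s3 is the normalized vector part of
    Q (lift s1), and conversely each s1 yields a curve, since any U rotating e
    to s2 provides suitable coefficients.  These are
    [transfer_of_RRMF5_I] and [RRMF5_I_of_transfer].

    The map X |-> Q X from the plane s0 X = X s2 to the plane s4 Y = Y s2
    commutes with right multiplication by s2, which is a complex structure on
    both planes.  In the real bases given by the base point and the oriented
    direction of the two circles this structure has the same matrix, because
    s0 . s2 = s4 . s2, so the map on vector parts has the form
    [[p, - K q], [q, p]] with K > 0 ([transfer_frame]).  Its determinant
    p ^ 2 + K q ^ 2 is positive: the induced map [circle_map] of the circles is
    therefore bijective, with inverse obtained by changing the sign of q, and
    preserves the orientation.  It is smooth since, along the arc length
    parametrization, its coordinates are polynomials in cos, sin and the inverse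
    square root of a positive trigonometric polynomial. *)

Set Implicit Arguments.
Unset Strict Implicit.
Unset Printing Implicit Defensive.

Import Order.TTheory GRing.Theory Num.Theory.
Import numFieldNormedType.Exports.

Local Open Scope classical_set_scope.
Local Open Scope ring_scope.

(** * Vectors of three-space *)

Section Vectors.
Variable R : realType.
Implicit Types (u v w x : 'rV[R]_3) (a b c : R).

Lemma row3P u : exists a b c, u = row3 a b c.
Proof.
exists (u 0 0), (u 0 (inord 1)), (u 0 (inord 2)).
apply/rowP => k; rewrite mxE.
by case: k => [[|[|[|]]]] // h /=; congr (u 0 _); apply/val_inj;
  rewrite /= ?inordK.
Qed.

Lemma row3E a b c : (row3 a b c 0 0 = a) * (row3 a b c 0 (inord 1) = b)
  * (row3 a b c 0 (inord 2) = c) * (row3 a b c 0 (inord 0) = a).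
Proof. by rewrite /row3 !mxE /= !inordK. Qed.

Lemma dotv_row3 a b c a' b' c' :
  dotv (row3 a b c) (row3 a' b' c') = a * a' + b * b' + c * c'.
Proof. by rewrite /dotv !big_ord_recl big_ord0 !mxE /= addr0 addrA. Qed.

Lemma crossv_row3 a b c a' b' c' :
  crossv (row3 a b c) (row3 a' b' c')
  = row3 (b * c' - c * b') (c * a' - a * c') (a * b' - b * a').
Proof. by rewrite /crossv !row3E. Qed.

Lemma add_row3 a b c a' b' c' :
  row3 a b c + row3 a' b' c' = row3 (a + a') (b + b') (c + c').
Proof. by apply/rowP => k; rewrite !mxE; case: k => [[|[|[|]]]]. Qed.

Lemma opp_row3 a b c : - row3 a b c = row3 (- a) (- b) (- c).
Proof. by apply/rowP => k; rewrite !mxE; case: k => [[|[|[|]]]]. Qed.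

Lemma scale_row3 l a b c : l *: row3 a b c = row3 (l * a) (l * b) (l * c).
Proof. by apply/rowP => k; rewrite !mxE; case: k => [[|[|[|]]]]. Qed.

Lemma zero_row3 : 0 = row3 0 0 0 :> 'rV[R]_3.
Proof. by apply/rowP => k; rewrite !mxE; case: k => [[|[|[|]]]]. Qed.

End Vectors.

Definition coord3E R := (zero_row3 R, @opp_row3 R, @add_row3 R, @scale_row3 R,
   @crossv_row3 R, @dotv_row3 R).

(** Every vector variable of the context is replaced by its coordinates, after
    which a vector identity is one ring identity per coordinate. *)
Ltac coords :=
  repeat match goal with u : 'rV_3 |- _ =>
    let a := fresh "a" in let b := fresh "b" in let c := fresh "c" in
    have [a [b [c ?]]] := row3P u; subst u end;
  rewrite ?coord3E.

Ltac vector_ring := intros; coords; try congr row3; ring.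

Section DotNorm.
Variable R : realType.
Implicit Types (u v w x : 'rV[R]_3) (a b c l : R).

Lemma dotvC u v : dotv u v = dotv v u. Proof. vector_ring. Qed.
Lemma dotvDl u v w : dotv (u + v) w = dotv u w + dotv v w.
Proof. vector_ring. Qed.
Lemma dotvZl l u v : dotv (l *: u) v = l * dotv u v. Proof. vector_ring. Qed.
Lemma dotvZr l u v : dotv u (l *: v) = l * dotv u v. Proof. vector_ring. Qed.
Lemma dotvDr u v w : dotv u (v + w) = dotv u v + dotv u w.
Proof. vector_ring. Qed.
Lemma dotvNl u v : dotv (- u) v = - dotv u v. Proof. vector_ring. Qed.
Lemma dotvNr u v : dotv u (- v) = - dotv u v. Proof. vector_ring. Qed.
Lemma crossvv u : crossv u u = 0. Proof. vector_ring. Qed.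
Lemma crossvC u v : crossv u v = - crossv v u. Proof. vector_ring. Qed.
Lemma crossv_crossv u v w :
  crossv u (crossv v w) = dotv u w *: v - dotv u v *: w.
Proof. vector_ring. Qed.
Lemma dotv_crossvv u v :
  dotv (crossv u v) (crossv u v) = dotv u u * dotv v v - dotv u v ^+ 2.
Proof. vector_ring. Qed.

Lemma dotvv_ge0 u : 0 <= dotv u u.
Proof. by apply: sumr_ge0 => k _; rewrite -expr2 sqr_ge0. Qed.

Lemma dotvv_eq0 u : (dotv u u == 0) = (u == 0).
Proof.
apply/eqP/eqP => [|->]; last by vector_ring.
move=> /eqP; rewrite psumr_eq0; last by move=> k _; rewrite -expr2 sqr_ge0.
move=> /allP h; apply/rowP => k; rewrite mxE.
by have := h k (mem_index_enum _); rewrite /= mulf_eq0 orbb => /eqP.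
Qed.

Lemma dotvv_gt0 u : (0 < dotv u u) = (u != 0).
Proof. by rewrite lt0r dotvv_ge0 andbT dotvv_eq0. Qed.

Lemma enorm_gt0 u : (0 < enorm u) = (u != 0).
Proof. by rewrite sqrtr_gt0 dotvv_gt0. Qed.

Lemma sphere2E u : sphere2 u <-> dotv u u = 1.
Proof.
rewrite /sphere2/= /enorm; split => [h|->]; last by rewrite sqrtr1.
by rewrite -(sqr_sqrtr (dotvv_ge0 u)) h expr1n.
Qed.

Lemma enormZ l u : 0 <= l -> enorm (l *: u) = l * enorm u.
Proof.
move=> l0; rewrite /enorm dotvZl dotvZr mulrA -expr2 sqrtrM ?sqr_ge0//.
by rewrite sqrtr_sqr ger0_norm.
Qed.

Lemma normalizeZ l u : 0 < l -> normalize (l *: u) = normalize u.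
Proof.
move=> l0; rewrite /normalize enormZ ?ltW// scalerA invfM mulrAC mulVf ?mul1r//.
by rewrite gt_eqF.
Qed.

Lemma normalize_id u : sphere2 u -> normalize u = u.
Proof. by move=> h; rewrite /normalize (h : enorm u = 1) invr1 scale1r. Qed.

Lemma normalizeE u : u != 0 -> u = enorm u *: normalize u.
Proof.
by move=> u0; rewrite scalerA divff ?scale1r// gt_eqF// enorm_gt0.
Qed.

Lemma sphere2_normalize u : u != 0 -> sphere2 (normalize u).
Proof.
move=> u0; rewrite /sphere2/= /normalize enormZ ?mulVf//.
  by rewrite gt_eqF// enorm_gt0.
by rewrite invr_ge0 sqrtr_ge0.
Qed.

Lemma sphere2_neq0 u : sphere2 u -> u != 0.
Proof. by move=> /sphere2E uu; rewrite -dotvv_gt0 uu. Qed.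

Lemma dot_sphere_neq1 u w : dotv u u = 1 -> dotv w w = 1 -> u <> w ->
  1 - dotv u w != 0.
Proof.
move=> uu ww uw; have -> : 1 - dotv u w = dotv (u - w) (u - w) / 2.
  by rewrite !dotvDl !dotvDr !dotvNl !dotvNr uu ww (dotvC w u); lra.
rewrite mulf_neq0 ?invr_eq0 ?pnatr_eq0// dotvv_eq0 subr_eq0.
exact/eqP.
Qed.

Lemma unit_dot1 u w : dotv u u = 1 -> dotv w w = 1 -> dotv u w = 1 -> u = w.
Proof.
move=> uu ww uw; apply: contrapT => /(dot_sphere_neq1 uu ww).
by rewrite uw subrr eqxx.
Qed.

Lemma neq_of_crossv u w : crossv u w != 0 -> u <> w.
Proof. by move=> h E; rewrite E crossvv eqxx in h. Qed.

End DotNorm.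

(** * Oriented great circles *)

Section FrameCircle.
Variable R : realType.
Implicit Types (b d x y : 'rV[R]_3) (t s : R).

Definition orthonormal_pair b d : Prop :=
  [/\ dotv b b = 1, dotv d d = 1 & dotv b d = 0].

(** This is [circle_param] for an arbitrary orthonormal frame, so that circles
    can be treated without the pair of points that they bisect. *)
Definition frame_circle b d t : 'rV[R]_3 := cos t *: b + sin t *: d.

Lemma dotv_frame_circle b d t : orthonormal_pair b d ->
  dotv (frame_circle b d t) b = cos t /\ dotv (frame_circle b d t) d = sin t.
Proof.
move=> [bb dd bd]; rewrite !dotvDl !dotvZl (dotvC d) bb dd bd.
by rewrite !mulr0 !mulr1 addr0 add0r.
Qed.

Lemma dotv_comb b d (p q p' q' : R) : orthonormal_pair b d ->
  dotv (p *: b + q *: d) (p' *: b + q' *: d) = p * p' + q * q'.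
Proof.
move=> [bb dd bd].
rewrite !dotvDl !dotvDr !dotvZl !dotvZr (dotvC d b) bb dd bd; ring.
Qed.

Lemma dotv_comb_crossv b d (p q : R) :
  dotv (p *: b + q *: d) (crossv b d) = 0.
Proof. vector_ring. Qed.

Lemma sphere2_frame_circle b d t :
  orthonormal_pair b d -> sphere2 (frame_circle b d t).
Proof.
by move=> bd; rewrite sphere2E dotv_comb// -!expr2 cos2Dsin2.
Qed.

Lemma frame_circleD2pi b d t :
  frame_circle b d (t + 2 * pi) = frame_circle b d t.
Proof.
by rewrite /frame_circle mulrC mulr_natr cosD2pi sinD2pi.
Qed.

Lemma angle_exists (p q : R) : p ^+ 2 + q ^+ 2 = 1 ->
  exists t : R, [/\ 0 <= t < 2 * pi, cos t = p & sin t = q].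
Proof.
move=> pq.
have p1 : -1 <= p <= 1.
  by rewrite -ler_norml -(@expr_le1 _ 2)// real_normK ?num_real// -pq lerDl
    sqr_ge0.
have pi0 := pi_gt0 R.
have a0 := acos_ge0 p1; have api := acos_lepi p1.
have sa : sin (acos p) = `|q|.
  by rewrite sin_acos// -pq addrAC subrr add0r sqrtr_sqr.
have ca : cos (acos p) = p by rewrite acosK.
have [q0|q0] := leP 0 q.
  exists (acos p); split; [lra | by [] | by rewrite sa ger0_norm].
(* [acos] covers the upper half of the circle; the lower half is its mirror
   image, moved by a full turn into [0, 2 pi). *)
exists (2 * pi - acos p).
have -> : 2 * pi - acos p = - acos p + pi *+ 2 by rewrite mulr2n; ring.
split; last 2 first.
- by rewrite cosD2pi cosN.
- by rewrite sinD2pi sinN sa ltr0_norm ?opprK.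
have : acos p != 0.
  apply/eqP => h; move: sa; rewrite h sin0 => /esym/eqP.
  by rewrite normr_eq0 (lt_eqF q0).
rewrite mulr2n neq_lt => /orP[]; lra.
Qed.

Lemma angle_unique t s : 0 <= t < 2 * pi -> 0 <= s < 2 * pi ->
  cos t = cos s -> sin t = sin s -> t = s.
Proof.
wlog ts : t s / t <= s.
  move=> H ht hs ct st; have [|/ltW] := leP t s; first by move=> h; apply: H.
  by move=> h; apply/esym/H.
move=> ht hs ct st; apply/eqP; rewrite eq_le ts/= leNgt; apply/negP => lt.
(* cos (s - t) = 1 - 2 sin ((s - t) / 2) ^ 2 < 1 when 0 < s - t < 2 pi. *)
have c1 : cos (s - t) = 1.
  by rewrite cosD cosN sinN ct st mulrN opprK -!expr2 cos2Dsin2.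
have : 0 < sin ((s - t) / 2).
  by apply: sin_gt0_pi; lra.
have := cosD ((s - t) / 2) ((s - t) / 2).
rewrite -splitr c1 -!expr2 => e s0.
have := cos2Dsin2 ((s - t) / 2).
have : sin ((s - t) / 2) ^+ 2 > 0 by rewrite exprn_gt0.
lra.
Qed.

Lemma frame_circle_inj b d t s : orthonormal_pair b d ->
  0 <= t < 2 * pi -> 0 <= s < 2 * pi ->
  frame_circle b d t = frame_circle b d s -> t = s.
Proof.
move=> bd ht hs e.
have [c1 s1] := dotv_frame_circle t bd; have [c2 s2] := dotv_frame_circle s bd.
by apply: angle_unique => //; [rewrite -c1 e c2 | rewrite -s1 e s2].
Qed.

Lemma orthonormal_expand b d x : orthonormal_pair b d ->
  dotv x (crossv b d) = 0 -> x = dotv x b *: b + dotv x d *: d.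
Proof.
move=> [bb dd bd] xf.
(* Crossing with the unit normal from the right and then from the left is the
   orthogonal projection onto the plane of the frame. *)
have fx : crossv (crossv b d) (crossv x (crossv b d)) = x.
  rewrite crossv_crossv (dotvC _ x) xf scale0r subr0.
  by rewrite dotv_crossvv bb dd bd expr0n/= subr0 mulr1 scale1r.
rewrite -[LHS]fx (crossv_crossv x) crossvC crossv_crossv.
rewrite !dotvDl !dotvNl !dotvZl (dotvC d b) bb dd bd; vector_ring.
Qed.

Lemma plane_circle b d x : orthonormal_pair b d -> sphere2 x ->
  dotv x (crossv b d) = 0 ->
  exists2 t, 0 <= t < 2 * pi & x = frame_circle b d t.
Proof.
move=> bd /sphere2E xx /(orthonormal_expand bd) xE.
have : dotv x b ^+ 2 + dotv x d ^+ 2 = 1.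
  by rewrite -xx [in RHS]xE dotv_comb// -!expr2.
move=> /angle_exists[t [ht ct st]].
by exists t => //; rewrite /frame_circle ct st.
Qed.

End FrameCircle.

Section OrientedCircle.
Variable R : realType.
Implicit Types (v w x : 'rV[R]_3).

Lemma addv_neq0 v w : crossv v w != 0 -> v + w != 0.
Proof.
apply: contra_neq => /(canRL (addKr _)); rewrite addr0 => ->; vector_ring.
Qed.

Lemma circle_orthonormal v w : crossv v w != 0 ->
  orthonormal_pair (circle_base v w) (circle_dir v w).
Proof.
move=> vw; have /sphere2_normalize/sphere2E := addv_neq0 vw.
have /sphere2E := sphere2_normalize vw.
rewrite /circle_base /circle_dir => dd bb; split=> //.
  by rewrite dotvNl dotvNr opprK.
rewrite /normalize dotvNr dotvZl dotvZr.
have -> : dotv (v + w) (crossv v w) = 0 by vector_ring.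
by rewrite !mulr0 oppr0.
Qed.

(** The axis of the frame is - crossv (v + w) (crossv v w) up to a positive
    factor, that is - (1 + v . w) (v - w), and 1 + v . w <> 0 as v and w are not
    opposite. *)
Lemma circle_normal v w x : sphere2 v -> sphere2 w -> crossv v w != 0 ->
  dotv x v = dotv x w <->
  dotv x (crossv (circle_base v w) (circle_dir v w)) = 0.
Proof.
move=> /sphere2E vv /sphere2E ww vw.
rewrite /circle_base /circle_dir /normalize.
set k := (enorm (v + w))^-1; set l := (enorm _)^-1.
have nz : - k * l * (1 + dotv v w) != 0.
  have k0 : 0 < k by rewrite invr_gt0 enorm_gt0 addv_neq0.
  have l0 : 0 < l by rewrite invr_gt0 enorm_gt0.
  rewrite !mulf_neq0 ?oppr_eq0 ?gt_eqF//.
  have -> : 1 + dotv v w = dotv (v + w) (v + w) / 2.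
    rewrite !dotvDl !dotvDr vv ww (dotvC w v); lra.
  by rewrite divr_gt0// dotvv_gt0 addv_neq0.
have -> : dotv x (crossv (k *: (v + w)) (- (l *: crossv v w)))
   = (- k * l * (1 + dotv v w)) * (dotv x v - dotv x w).
  have -> : crossv (k *: (v + w)) (- (l *: crossv v w))
     = - k * l *: (crossv (v + w) (crossv v w)) by vector_ring.
  rewrite dotvZr -mulrA; congr (_ * _).
  rewrite crossv_crossv !dotvDl vv ww (dotvC w v).
  rewrite dotvDr dotvNr !dotvZr; ring.
split=> [->|/eqP]; first by rewrite subrr mulr0.
by rewrite mulf_eq0 (negbTE nz) subr_eq0 => /eqP.
Qed.

Lemma circle_param_in v w t : sphere2 v -> sphere2 w -> crossv v w != 0 ->
  great_circle v w (circle_param v w t).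
Proof.
move=> hv hw vw; have bd := circle_orthonormal vw.
split; first exact: (sphere2_frame_circle t bd).
by apply/(circle_normal _ hv hw vw); exact: dotv_comb_crossv.
Qed.

Lemma great_circleP v w x : sphere2 v -> sphere2 w -> crossv v w != 0 ->
  great_circle v w x <->
  exists2 t, 0 <= t < 2 * pi & x = circle_param v w t.
Proof.
move=> hv hw vw; have bd := circle_orthonormal vw; split.
  by move=> [sx /(circle_normal x hv hw vw)] /plane_circle; exact.
by move=> [t _ ->]; exact: circle_param_in.
Qed.

End OrientedCircle.

(** * Maps between circles induced by linear maps *)

Section FrameMap.
Variable R : realType.
Implicit Types (b d x y : 'rV[R]_3) (t s K p q : R).

(** The linear map with matrix [[p, - K q], [q, p]] from the frame (b, d) to the
    frame (b', d').  For K = 1 these are the direct similarities; for K > 0 the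
    family is conjugate to them, hence closed under inverses up to a factor. *)
Definition frame_map b d b' d' K p q x : 'rV[R]_3 :=
  (p * dotv x b - K * q * dotv x d) *: b' + (q * dotv x b + p * dotv x d) *: d'.

Lemma frame_mapZ b d b' d' K p q l x :
  frame_map b d b' d' K p q (l *: x) = l *: frame_map b d b' d' K p q x.
Proof.
rewrite /frame_map !dotvZl scalerDr !scalerA; congr (_ *: _ + _ *: _); ring.
Qed.

(** The matrices with q and - q are adjugate to each other. *)
Lemma frame_mapK b d b' d' K p q x :
  orthonormal_pair b d -> orthonormal_pair b' d' ->
  dotv x (crossv b d) = 0 ->
  frame_map b' d' b d K p (- q) (frame_map b d b' d' K p q x)
  = (p ^+ 2 + K * q ^+ 2) *: x.
Proof.
move=> bd bd' /(orthonormal_expand bd) xE.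
have [bb' dd' bd0'] := bd'.
rewrite [in RHS]xE /frame_map !dotvDl !dotvZl (dotvC d' b') bb' dd' bd0'.
rewrite scalerDr !scalerA; congr (_ *: _ + _ *: _); ring.
Qed.

Lemma frame_map_neq0 b d b' d' K p q x :
  orthonormal_pair b d -> orthonormal_pair b' d' ->
  dotv x (crossv b d) = 0 -> x != 0 -> 0 < p ^+ 2 + K * q ^+ 2 ->
  frame_map b d b' d' K p q x != 0.
Proof.
move=> bd bd' xf x0 D0; apply/eqP => e.
have := frame_mapK K p q bd bd' xf; rewrite e -(scale0r x) frame_mapZ scale0r.
by move=> /esym/eqP; rewrite scaler_eq0 (negbTE x0) gt_eqF.
Qed.

Definition circle_map b d b' d' K p q x : 'rV[R]_3 :=
  normalize (frame_map b d b' d' K p q x).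

Lemma circle_map_in b d b' d' K p q x :
  orthonormal_pair b d -> orthonormal_pair b' d' ->
  0 < p ^+ 2 + K * q ^+ 2 -> sphere2 x -> dotv x (crossv b d) = 0 ->
  sphere2 (circle_map b d b' d' K p q x) /\
  dotv (circle_map b d b' d' K p q x) (crossv b' d') = 0.
Proof.
move=> bd bd' D0 sx xf; split; last first.
  by rewrite /circle_map /normalize dotvZl dotv_comb_crossv mulr0.
apply: sphere2_normalize; apply: frame_map_neq0 => //.
exact: sphere2_neq0.
Qed.

Lemma circle_mapK b d b' d' K p q x :
  orthonormal_pair b d -> orthonormal_pair b' d' ->
  0 < p ^+ 2 + K * q ^+ 2 -> sphere2 x -> dotv x (crossv b d) = 0 ->
  circle_map b' d' b d K p (- q) (circle_map b d b' d' K p q x) = x.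
Proof.
move=> bd bd' D0 sx xf; have Fx : frame_map b d b' d' K p q x != 0.
  apply: frame_map_neq0 => //.
  exact: sphere2_neq0.
have E : circle_map b d b' d' K p q x
  = (enorm (frame_map b d b' d' K p q x))^-1 *: frame_map b d b' d' K p q x.
  by [].
rewrite E /circle_map frame_mapZ normalizeZ ?invr_gt0 ?enorm_gt0//.
by rewrite frame_mapK// normalizeZ// normalize_id.
Qed.

End FrameMap.

(** * Smoothness of circle maps *)

Section Smoothness.
Variable R : realType.
Implicit Types (b d x y : 'rV[R]_3) (t s K p q : R) (f g : R -> R).

(** The algebra generated by cos, sin and a weight w.  If w' belongs to it, then
    it is stable under differentiation, so all its elements are smooth, without
    formulas for the higher derivatives of products and compositions. *)
Inductive trig_rational (w : R -> R) : (R -> R) -> Prop :=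
| trig_cst c : trig_rational w (fun=> c)
| trig_cos : trig_rational w cos
| trig_sin : trig_rational w sin
| trig_weight : trig_rational w w
| trig_opp f : trig_rational w f -> trig_rational w (fun t => - f t)
| trig_add f g : trig_rational w f -> trig_rational w g ->
    trig_rational w (fun t => f t + g t)
| trig_mul f g : trig_rational w f -> trig_rational w g ->
    trig_rational w (fun t => f t * g t).

Lemma trig_rational_derive w dw f : trig_rational w dw ->
  (forall t, is_derive t 1 w (dw t)) -> trig_rational w f ->
  exists2 df, trig_rational w df & forall t, is_derive t 1 f (df t).
Proof.
move=> hdw wdw; elim=> {f}.
- move=> c; exists (fun=> 0); first exact: trig_cst.
  by move=> t; exact: is_derive_cst.
- exists (fun t => - sin t); first by apply: trig_opp; exact: trig_sin.
  by move=> t; exact: is_derive_cos.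
- by exists cos; [exact: trig_cos|move=> t; exact: is_derive_sin].
- by exists dw.
- move=> f _ [df hdf fdf].
  by exists (fun t => - df t); [exact: trig_opp|move=> t; exact: is_deriveN].
- move=> f g _ [df hdf fdf] _ [dg hdg gdg].
  exists (fun t => df t + dg t); first exact: trig_add.
  by move=> t; exact: is_deriveD.
- move=> f g hf [df hdf fdf] hg [dg hdg gdg].
  exists (fun t => f t * dg t + g t * df t).
    by apply: trig_add; exact: trig_mul.
  by move=> t; exact: is_deriveM.
Qed.

Lemma is_derive_comb f g b d t (df dg : R) :
  is_derive t 1 f df -> is_derive t 1 g dg ->
  is_derive t 1 (fun s => f s *: b + g s *: d) (df *: b + dg *: d).
Proof.
move=> hf hg.
have H i j : is_derive t 1 (fun s => (f s *: b + g s *: d) i j)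
    ((df *: b + dg *: d) i j).
  rewrite !mxE.
  have -> : (fun s => (f s *: b + g s *: d) i j)
      = (f * cst (b i j) + g * cst (d i j)).
    by apply/funext => s; rewrite !mxE.
  apply: is_derive_eq.
  by rewrite !scaler0 !add0r /GRing.scale/= (mulrC df) (mulrC dg).
have D : derivable (fun s => f s *: b + g s *: d) t 1.
  by apply/derivable_mxP => i j; have [] := H i j.
split=> //; rewrite derive_mx//; apply/matrixP => i j; rewrite mxE.
by have [_ ->] := H i j.
Qed.

Lemma smooth_trig_comb w dw f g b d : trig_rational w dw ->
  (forall t, is_derive t 1 w (dw t)) ->
  trig_rational w f -> trig_rational w g ->
  smooth_curve (fun t => f t *: b + g t *: d).
Proof.
move=> hdw wdw hf hg n.
suff [f' [g' [/(trig_rational_derive hdw wdw)[df _ fdf]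
  /(trig_rational_derive hdw wdw)[dg _ gdg] ->]]] : exists f' g',
  [/\ trig_rational w f', trig_rational w g' &
   derive1n n (fun t => f t *: b + g t *: d) = fun t => f' t *: b + g' t *: d].
  by move=> t; have [] := is_derive_comb b d (fdf t) (gdg t).
elim: n => [|n [f' [g' [/(trig_rational_derive hdw wdw)[df hdf fdf]
  /(trig_rational_derive hdw wdw)[dg hdg gdg] E]]]]; first by exists f, g.
exists df, dg; split=> //; rewrite derive1nS E; apply/funext => t.
by rewrite derive1E; have [_ ->] := is_derive_comb b d (fdf t) (gdg t).
Qed.

Lemma smooth_frame_circle b d : smooth_curve (frame_circle b d).
Proof.
apply: (@smooth_trig_comb (cst 0) (fun=> 0)).
- exact: trig_cst.
- exact: trig_cos.
- exact: trig_sin.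
Qed.

Section Curve.
Variables (b d b' d' : 'rV[R]_3) (K p q : R).
Hypotheses (bd : orthonormal_pair b d) (bd' : orthonormal_pair b' d').
Hypothesis D0 : 0 < p ^+ 2 + K * q ^+ 2.

(* A and B are the coordinates of [frame_map] along the circle, dA and dB their
   derivatives, and w normalizes (A, B). *)
Let A t := p * cos t + (- (K * q)) * sin t.
Let B t := q * cos t + p * sin t.
Let dA t := p * (- sin t) + (- (K * q)) * cos t.
Let dB t := q * (- sin t) + p * cos t.
Let w t : R := (Num.sqrt (A t * A t + B t * B t))^-1.

Let wronskian t : A t * dB t - dA t * B t = p ^+ 2 + K * q ^+ 2.
Proof.
rewrite -[RHS]mulr1 -(cos2Dsin2 t) /A /B /dA /dB; ring.
Qed.

Let AB_gt0 t : 0 < A t * A t + B t * B t.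
Proof.
rewrite -!expr2 lt0r addr_ge0 ?sqr_ge0// andbT paddr_eq0 ?sqr_ge0//.
apply/negP; rewrite !sqrf_eq0 => /andP[/eqP a /eqP b0].
by move: D0; rewrite -(wronskian t) a b0 mul0r mulr0 subrr ltxx.
Qed.

Let is_derive_A t : is_derive t 1 A (dA t).
Proof.
rewrite /A /dA; have -> : (fun t => p * cos t + - (K * q) * sin t)
  = cst p * cos + cst (- (K * q)) * sin by [].
by apply: is_derive_eq; rewrite /GRing.scale/= !mulr0 !addr0.
Qed.

Let is_derive_B t : is_derive t 1 B (dB t).
Proof.
rewrite /B /dB; have -> : (fun t => q * cos t + p * sin t)
  = cst q * cos + cst p * sin by [].
by apply: is_derive_eq; rewrite /GRing.scale/= !mulr0 !addr0.
Qed.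

(* Written with w instead of a fractional power: w' lies in the algebra. *)
Let dw t : R := - (A t * dA t + B t * dB t) * (w t * w t * w t).

Let is_derive_w t : is_derive t 1 w (dw t).
Proof.
pose N : R -> R := A * A + B * B.
have NE s : N s = A s * A s + B s * B s by [].
have hN : is_derive t 1 N (2 * (A t * dA t + B t * dB t)).
  by apply: is_derive_eq; rewrite /GRing.scale/= /dA /dB; ring.
have S0 : Num.sqrt (N t) != 0 by rewrite gt_eqF// sqrtr_gt0 NE.
have hs : is_derive t 1 (Num.sqrt \o N)
   ((2 * Num.sqrt (N t))^-1 * (2 * (A t * dA t + B t * dB t))).
  apply: is_derive1_comp => //; apply: is_derive1_sqrt; rewrite NE.
  exact: AB_gt0.
have -> : w = (fun s => ((Num.sqrt \o N) s)^-1) by [].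
have [hsd hsv] := hs.
apply: (@DeriveDef _ _ _ _ _ (fun s => ((Num.sqrt \o N) s)^-1)).
  exact: derivableV.
rewrite deriveV// hsv /dw /w /= NE; rewrite NE in S0.
by rewrite /GRing.scale/=; field.
Qed.

Lemma circle_map_frame_circle t :
  circle_map b d b' d' K p q (frame_circle b d t)
  = (A t * w t) *: b' + (B t * w t) *: d'.
Proof.
have [xb xd] := dotv_frame_circle t bd.
rewrite /circle_map /frame_map xb xd /normalize /enorm dotv_comb//.
rewrite scalerDr !scalerA; congr (_ *: _ + _ *: _).
  by rewrite mulrC /A /w /A /B mulNr.
by rewrite mulrC /B /w /A /B mulNr.
Qed.

Lemma smooth_circle_map :
  smooth_curve (circle_map b d b' d' K p q \o frame_circle b d).
Proof.
have -> : (circle_map b d b' d' K p q \o frame_circle b d)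
  = fun t => (A t * w t) *: b' + (B t * w t) *: d'.
  by apply/funext => t; exact: circle_map_frame_circle.
apply: (@smooth_trig_comb w dw) => //.
- rewrite /dw /dA /dB; repeat constructor.
- by repeat constructor.
- by repeat constructor.
Qed.

(** The derivative of (A, B) / |(A, B)| is the rotation of that unit vector by a
    right angle, times the Wronskian of A and B divided by |(A, B)| ^ 2; the
    Wronskian is the determinant of the linear map. *)
Lemma derive_circle_map t :
  exists2 c, 0 < c &
  derive1 (circle_map b d b' d' K p q \o frame_circle b d) t
  = c *: crossv (crossv b' d')
      (circle_map b d b' d' K p q (frame_circle b d t)).
Proof.
have -> : (circle_map b d b' d' K p q \o frame_circle b d)
  = fun t => (A t * w t) *: b' + (B t * w t) *: d'.
  by apply/funext => s; exact: circle_map_frame_circle.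
have hA : is_derive t 1 (fun t => A t * w t) (A t * dw t + w t * dA t).
  exact: is_deriveM.
have hB : is_derive t 1 (fun t => B t * w t) (B t * dw t + w t * dB t).
  exact: is_deriveM.
exists ((p ^+ 2 + K * q ^+ 2) * w t ^+ 2).
  by rewrite mulr_gt0// exprn_gt0// invr_gt0 sqrtr_gt0.
rewrite derive1E; have [_ ->] := is_derive_comb b' d' hA hB.
rewrite circle_map_frame_circle.
have [bb' dd' bd0'] := bd'.
have -> : crossv (crossv b' d') ((A t * w t) *: b' + (B t * w t) *: d')
  = (- (B t * w t)) *: b' + (A t * w t) *: d'.
  rewrite crossvC crossv_crossv !dotvDl !dotvZl (dotvC d' b') bb' dd' bd0'.
  by rewrite !mulr0 !mulr1 addr0 add0r opprB scaleNr addrC.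
have W : w t ^+ 2 * (A t * A t + B t * B t) = 1.
  rewrite /w exprVn sqr_sqrtr; last exact/ltW.
  by rewrite mulVf// gt_eqF.
rewrite scalerDr !scalerA -(wronskian t) /dw.
(* The terms not cubic in w become so after multiplication by
   1 = w ^ 2 (A ^ 2 + B ^ 2). *)
congr (_ *: _ + _ *: _).
  by rewrite -[w t * dA t]mul1r -W; ring.
by rewrite -[w t * dB t]mul1r -W; ring.
Qed.
End Curve.
End Smoothness.

(** * The quaternion algebra *)

Section QuatRing.
Variable R : realType.

Lemma quat_mulA : associative (@quat_mul R).
Proof.
by move=> [x0 x] [y0 y] [z0 z]; rewrite /quat_mul /=; congr pair; vector_ring.
Qed.
Lemma quat_mul1q : left_id ((1, 0) : quaternion R) (@quat_mul R).
Proof. by move=> [y0 y]; rewrite /quat_mul /=; congr pair; vector_ring. Qed.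
Lemma quat_mulq1 : right_id ((1, 0) : quaternion R) (@quat_mul R).
Proof. by move=> [y0 y]; rewrite /quat_mul /=; congr pair; vector_ring. Qed.

HB.instance Definition _ := GRing.Lmodule.on (quaternion R).

Lemma quat_addE (a b : R) (u v : 'rV[R]_3) :
  ((a, u) : quaternion R) + ((b, v) : quaternion R) = (a + b, u + v).
Proof. by []. Qed.

Lemma quat_mulDl : left_distributive (@quat_mul R) +%R.
Proof.
move=> [x0 x] [y0 y] [z0 z]; rewrite quat_addE /quat_mul /= quat_addE.
by congr pair; vector_ring.
Qed.
Lemma quat_mulDr : right_distributive (@quat_mul R) +%R.
Proof.
move=> [x0 x] [y0 y] [z0 z]; rewrite quat_addE /quat_mul /= quat_addE.
by congr pair; vector_ring.
Qed.
Lemma quat_oner_neq0 : ((1, 0) : quaternion R) != 0.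
Proof. by apply/eqP => -[] /eqP; rewrite oner_eq0. Qed.

HB.instance Definition _ := GRing.Zmodule_isNzRing.Build (quaternion R)
  quat_mulA quat_mul1q quat_mulq1 quat_mulDl quat_mulDr quat_oner_neq0.

Lemma quat_mulE (a b : R) (u v : 'rV[R]_3) :
  ((a, u) : quaternion R) * ((b, v) : quaternion R)
  = (a * b - dotv u v, a *: v + b *: u + crossv u v).
Proof. by []. Qed.
Lemma quat_scaleE (l a : R) (u : 'rV[R]_3) :
  l *: ((a, u) : quaternion R) = (l * a, l *: u).
Proof. by []. Qed.

Lemma quat_scaleAl (a : R) (A B : quaternion R) : a *: (A * B) = a *: A * B.
Proof.
case: A B => [x0 x] [y0 y]; rewrite !(quat_scaleE, quat_mulE).
by congr pair; vector_ring.
Qed.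
HB.instance Definition _ := GRing.Lmodule_isLalgebra.Build R (quaternion R)
  quat_scaleAl.
Lemma quat_scaleAr (a : R) (A B : quaternion R) : a *: (A * B) = A * (a *: B).
Proof.
case: A B => [x0 x] [y0 y]; rewrite !(quat_scaleE, quat_mulE).
by congr pair; vector_ring.
Qed.
HB.instance Definition _ := GRing.Lalgebra_isAlgebra.Build R (quaternion R)
  quat_scaleAr.
End QuatRing.

Section QuatNorm.
Variable R : realType.
Implicit Types (A B X : quaternion R) (u v w x e s : 'rV[R]_3) (l : R).

Definition qnorm A : R := A.1 ^+ 2 + dotv A.2 A.2.

Lemma quat_conjM A B : quat_conj (A * B) = quat_conj B * quat_conj A.
Proof.
case: A B => [a u] [b v]; rewrite /quat_conj !quat_mulE /=.
by congr pair; vector_ring.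
Qed.

Lemma quat_conjK A : quat_conj (quat_conj A) = A.
Proof. by case: A => a u; rewrite /quat_conj /= opprK. Qed.

Lemma quat_conjZ l A : quat_conj (l *: A) = l *: quat_conj A.
Proof. by case: A => a u; rewrite /quat_conj !quat_scaleE /= scalerN. Qed.

Lemma quat_conjN A : quat_conj (- A) = - quat_conj A.
Proof. by rewrite -scaleN1r quat_conjZ scaleN1r. Qed.

Lemma quat_conj_pure u : quat_conj (pure u) = - pure u.
Proof. by rewrite /quat_conj /pure /= -[in LHS]oppr0. Qed.

Lemma quat_1E : (1 : quaternion R) = (1, 0). Proof. by []. Qed.

Lemma quat_mul_conj A : A * quat_conj A = qnorm A *: 1.
Proof.
case: A => a u; rewrite quat_1E quat_scaleE /quat_conj quat_mulE /qnorm /=.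
by congr pair; vector_ring.
Qed.

Lemma qnorm_conj A : qnorm (quat_conj A) = qnorm A.
Proof. by case: A => a u; rewrite /qnorm /= dotvNl dotvNr opprK. Qed.

Lemma quat_conj_mul A : quat_conj A * A = qnorm A *: 1.
Proof. by rewrite -{2}[A]quat_conjK quat_mul_conj qnorm_conj. Qed.

Lemma qnormM A B : qnorm (A * B) = qnorm A * qnorm B.
Proof.
by case: A B => [a u] [b v]; rewrite quat_mulE /qnorm /=; vector_ring.
Qed.

Lemma qnormZ l A : qnorm (l *: A) = l ^+ 2 * qnorm A.
Proof. by case: A => [a u]; rewrite quat_scaleE /qnorm /=; vector_ring. Qed.

Lemma qnorm_ge0 A : 0 <= qnorm A.
Proof. by rewrite addr_ge0 ?sqr_ge0// dotvv_ge0. Qed.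

Lemma qnorm_gt0 A : (0 < qnorm A) = (A != 0).
Proof.
case: A => a u; rewrite lt0r qnorm_ge0 andbT /qnorm /=.
rewrite paddr_eq0 ?sqr_ge0 ?dotvv_ge0// sqrf_eq0 dotvv_eq0.
by rewrite -[in RHS]pair_eqE.
Qed.

Lemma qnorm_pure u : qnorm (pure u) = dotv u u.
Proof. by rewrite /qnorm /= expr0n add0r. Qed.

Lemma pureZ l u : pure (l *: u) = l *: pure u.
Proof. by rewrite /pure quat_scaleE mulr0. Qed.

Lemma pure_sqr u : dotv u u = 1 -> pure u * pure u = - 1.
Proof.
move=> uu; rewrite /pure quat_mulE uu crossvv !scale0r !addr0 mulr0 sub0r.
by rewrite quat_1E -[in LHS]oppr0.
Qed.

Lemma rotation_intertwines A e s : pure s * A = A * pure e ->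
  A * pure e * quat_conj A = qnorm A *: pure s.
Proof. by move=> <-; rewrite -mulrA quat_mul_conj -scalerAr mulr1. Qed.

(** Taking norms gives |A| ^ 2 = l; multiplying by A on the right then turns the
    rotation of e to s into a linear condition on A. *)
Lemma intertwines_rotation A e s l : dotv e e = 1 -> dotv s s = 1 -> 0 < l ->
  A * pure e * quat_conj A = pure (l *: s) ->
  qnorm A = l /\ pure s * A = A * pure e.
Proof.
move=> ee ss l0 h.
have nA : qnorm A = l.
  have := congr1 qnorm h.
  rewrite !qnormM qnorm_conj !qnorm_pure dotvZl dotvZr ee ss !mulr1 -!expr2.
  by move=> /eqP; rewrite eqrXn2 ?qnorm_ge0// ?ltW// => /eqP.
split=> //; apply: (scalerI (negbT (gt_eqF l0))).
have := congr1 ( *%R^~ A) h.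
by rewrite -mulrA quat_conj_mul -scalerAr mulr1 nA pureZ -scalerAl => ->.
Qed.

Lemma conj_intertwines A e s : pure s * A = A * pure e ->
  quat_conj A * pure s = pure e * quat_conj A.
Proof.
move=> /(congr1 (@quat_conj R)); rewrite !quat_conjM !quat_conj_pure.
by rewrite mulrN mulNr => /oppr_inj.
Qed.

End QuatNorm.

(** * Quaternions intertwining two unit vectors *)

Section Lift.
Variable R : realType.
Implicit Types (A B X : quaternion R) (u v w x e s : 'rV[R]_3) (l : R).

(** The scalar part is the only one for which u X = X w can hold with vector
    part x: the vector part of the equation is x0 (u - w) = - crossv (u + w) x,
    and x0 is read off from its product with u - w. *)
Definition lift_quat u w x : quaternion R :=
  (- dotv x (crossv u w) / (1 - dotv u w), x).

Lemma lift_quatZ u w l x : lift_quat u w (l *: x) = l *: lift_quat u w x.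
Proof. by rewrite /lift_quat quat_scaleE dotvZl -mulrN mulrA. Qed.

Lemma lift_quatD u w x y :
  lift_quat u w (x + y) = lift_quat u w x + lift_quat u w y.
Proof. by rewrite /lift_quat quat_addE dotvDl opprD mulrDl. Qed.

(** Since x and u + w are both orthogonal to n = u - w, their cross product is
    parallel to n, so it is determined by its product with n. *)
Lemma lift_quat_intertwines u w x : dotv u u = 1 -> dotv w w = 1 -> u <> w ->
  dotv x u = dotv x w -> pure u * lift_quat u w x = lift_quat u w x * pure w.
Proof.
move=> uu ww uw xuw; have c0 := dot_sphere_neq1 uu ww uw.
rewrite /lift_quat /pure !quat_mulE !scale0r !addr0 !mul0r !mulr0 !sub0r.
rewrite add0r dotvC xuw; congr pair.
set x0 := _ / _.
have E : (1 - dotv u w) *: (x0 *: (u - w) + crossv (u + w) x) = 0.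
  rewrite scalerDr scalerA mulrC divfK//.
  have H : crossv (u - w) (crossv (crossv (u + w) x) (u - w)) = 0.
    rewrite (crossvC _ (u - w)) crossv_crossv.
    have -> : dotv (u - w) x = 0.
      by rewrite dotvDl dotvNl !(dotvC _ x) xuw subrr.
    have -> : dotv (u - w) (u + w) = 0.
      by rewrite !dotvDl !dotvDr !dotvNl uu ww (dotvC w u); ring.
    by rewrite !scale0r subrr oppr0; vector_ring.
  move: H; rewrite crossv_crossv.
  have -> : dotv (u - w) (u - w) = 2 * (1 - dotv u w).
    by rewrite !dotvDl !dotvDr !dotvNl !dotvNr uu ww (dotvC w u); ring.
  have -> : dotv (u - w) (crossv (u + w) x) = 2 * dotv x (crossv u w).
    by vector_ring.
  rewrite -!scalerA -scalerBr => /eqP.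
  rewrite scaler_eq0 pnatr_eq0/= => /eqP <-.
  by rewrite addrC scaleNr.
move/eqP : E; rewrite scaler_eq0 (negbTE c0)/= => /eqP E.
apply/eqP; rewrite -subr_eq0 -E; apply/eqP; move: x0 {E} => x0.
clear; vector_ring.
Qed.

Lemma lift_quat_unique u w X : dotv u u = 1 -> dotv w w = 1 -> u <> w ->
  pure u * X = X * pure w -> X = lift_quat u w X.2 /\ dotv X.2 u = dotv X.2 w.
Proof.
case: X => x0 x uu ww uw; have c0 := dot_sphere_neq1 uu ww uw.
rewrite /lift_quat /pure !quat_mulE !scale0r !addr0 !mul0r !mulr0 !sub0r add0r.
rewrite (dotvC u) /= => -[/oppr_inj xuw E]; split=> //; congr pair.
apply: (mulIf c0); rewrite divfK//.
have := congr1 (dotv (u - w)) E.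
rewrite !dotvDl !dotvDr !dotvNl !dotvZr uu ww (dotvC w u) => F.
have G1 : dotv u (crossv u x) = 0 by clear; vector_ring.
have G2 : dotv w (crossv u x) = dotv x (crossv w u) by clear; vector_ring.
have G3 : dotv u (crossv x w) = dotv x (crossv w u) by clear; vector_ring.
have G4 : dotv w (crossv x w) = 0 by clear; vector_ring.
have G5 : dotv x (crossv u w) = - dotv x (crossv w u) by clear; vector_ring.
rewrite G1 G2 G3 G4 in F; rewrite G5 opprK; lra.
Qed.

End Lift.

Section Rotor.
Variable R : realType.

(** Every U = V - s V e satisfies s U = U e.  If all of them vanished, V = 1
    would give s = - e, and then e would commute with every quaternion. *)
Lemma rotor_exists (e s : 'rV[R]_3) : dotv e e = 1 -> dotv s s = 1 ->
  exists U, qnorm U = 1 /\ pure s * U = U * pure e.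
Proof.
move=> ee ss.
have [V VU] : exists V : quaternion R, V - pure s * V * pure e != 0.
  apply: contrapT => /forallNP H.
  have {}H V : V = pure s * V * pure e.
    by apply/eqP; rewrite -subr_eq0; apply/negP => /negP/H.
  have se : pure s = - pure e.
    have := H 1; rewrite mulr1 => /(congr1 ( *%R (pure s))).
    by rewrite mulrA pure_sqr// mulN1r mulr1.
  have comm (v : 'rV[R]_3) : crossv e v = 0.
    have := H (pure v); rewrite se mulNr => /(congr1 ( *%R^~ (pure e))).
    rewrite !mulNr -!mulrA pure_sqr// !mulrN mulr1 opprK.
    rewrite /pure !quat_mulE !scale0r !add0r => -[_].
    rewrite crossvC => /eqP; rewrite eq_sym -addr_eq0 -mulr2n => h.
    apply/eqP; move: h; rewrite -scaler_nat scaler_eq0 pnatr_eq0/=.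
    by [].
  have [a [b [c E]]] := row3P e.
  move: ee (comm (row3 1 0 0)) (comm (row3 0 1 0)).
  rewrite E zero_row3 !crossv_row3 dotv_row3 => ee h1 h2.
  have := congr1 (fun r : 'rV[R]_3 => r 0 (inord 1)) h1.
  have := congr1 (fun r : 'rV[R]_3 => r 0 (inord 2)) h1.
  have := congr1 (fun r : 'rV[R]_3 => r 0 (inord 2)) h2.
  rewrite !row3E => x1 x2 x3; move: ee.
  have -> : a = 0 by lra.
  have -> : b = 0 by lra.
  have -> : c = 0 by lra.
  by rewrite mul0r !addr0 => /eqP; rewrite eq_sym oner_eq0.
set U := V - _ in VU.
have U0 : 0 < qnorm U by rewrite qnorm_gt0.
exists ((Num.sqrt (qnorm U))^-1 *: U); split.
  by rewrite qnormZ exprVn sqr_sqrtr ?ltW// mulVf// gt_eqF.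
rewrite -scalerAl -scalerAr; congr (_ *: _).
rewrite /U mulrBr mulrBl !mulrA pure_sqr// mulN1r.
rewrite -(mulrA _ (pure e)) pure_sqr//.
by rewrite mulNr mulrN mulr1 !opprK addrC.
Qed.
End Rotor.

(** * Hodographs and their control points *)

Section Bernstein.
Variable R : realType.

Lemma antiderivative (P : {poly R}) : exists Q : {poly R}, deriv Q = P.
Proof.
exists (\poly_(i < (size P).+1) (P`_i.-1 / i%:R)); apply/polyP => i.
rewrite coef_deriv coef_poly ltnS /=.
case: ltnP => [_|h]; last by rewrite mul0rn nth_default.
by rewrite -[LHS]mulr_natr divfK// pnatr_eq0.
Qed.

Definition bernstein_poly (n i : nat) : {poly R} :=
  'C(n, i)%:R *: ('X ^+ i * (1 - 'X) ^+ (n - i)).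

Lemma horner_bernstein_poly n i t : (bernstein_poly n i).[t] = bernstein n i t.
Proof. by rewrite /bernstein_poly /bernstein !hornerE. Qed.

Lemma bernstein4E t :
  [/\ bernstein 4 0 t = (1 - t) ^+ 4, bernstein 4 1 t = 4 * t * (1 - t) ^+ 3,
   bernstein 4 2 t = 6 * t ^+ 2 * (1 - t) ^+ 2,
   bernstein 4 3 t = 4 * t ^+ 3 * (1 - t)
  & bernstein 4 4 t = t ^+ 4 :> R].
Proof.
have -> : bernstein 4 1 t = 4 * t * (1 - t) ^+ 3 by rewrite /bernstein expr1.
have -> : bernstein 4 3 t = 4 * t ^+ 3 * (1 - t) by rewrite /bernstein expr1.
by split=> //; rewrite /bernstein /= ?expr0 ?mul1r ?mulr1.
Qed.

Lemma bernstein4_sum (V : lmodType R) (h : 'I_5 -> V) t :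
  \sum_(i < 5) bernstein 4 i t *: h i =
  (1 - t) ^+ 4 *: h (inord 0) + (4 * t * (1 - t) ^+ 3) *: h (inord 1)
  + (6 * t ^+ 2 * (1 - t) ^+ 2) *: h (inord 2)
  + (4 * t ^+ 3 * (1 - t)) *: h (inord 3) + t ^+ 4 *: h (inord 4).
Proof.
have [<- <- <- <- <-] := bernstein4E t.
rewrite !big_ord_recl big_ord0 /= addr0 !addrA.
by congr (_ *: h _ + _ *: h _ + _ *: h _ + _ *: h _ + _ *: h _);
  apply/val_inj; rewrite /= inordK.
Qed.

Lemma ord5P (P : 'I_5 -> Prop) : P (inord 0) -> P (inord 1) -> P (inord 2) ->
  P (inord 3) -> P (inord 4) -> forall i, P i.
Proof.
move=> P0 P1 P2 P3 P4 i; rewrite -(inord_val i).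
by case: i => -[|[|[|[|[|]]]]].
Qed.

(** A quartic is determined by its values at 0, 1/4, 1/2, 3/4 and 1. *)
Lemma bernstein4_free (h g : 'I_5 -> 'rV[R]_3) :
  (forall t : R, 0 <= t <= 1 ->
     \sum_(i < 5) bernstein 4 i t *: h i =
     \sum_(i < 5) bernstein 4 i t *: g i) ->
  h = g.
Proof.
move=> H; apply/funext => i; apply/rowP => k.
pose f j : R^o := h j 0 k - g j 0 k.
suff /eqP : f i = 0 by rewrite subr_eq0 => /eqP.
have F t : 0 <= t <= 1 -> \sum_(j < 5) bernstein 4 j t *: f j = 0.
  move=> /H /(congr1 (fun r : 'rV[R]_3 => r 0 k)); rewrite !summxE => /eqP.
  rewrite -subr_eq0 -sumrB => /eqP E; rewrite -[RHS]E; apply: eq_bigr => j _.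
  by rewrite !mxE scalerBr.
have := F 0; have := F 1; have := F (1 / 4).
have := F (1 / 2); have := F (3 / 4).
rewrite !bernstein4_sum /GRing.scale/= => h1 h2 h3 h4 h5.
have {h1} := h1 ltac:(lra); have {h2} := h2 ltac:(lra).
have {h3} := h3 ltac:(lra); have {h4} := h4 ltac:(lra).
have {h5} := h5 ltac:(lra).
by elim/ord5P: i; lra.
Qed.
End Bernstein.

Section Hodograph.
Variable R : realType.
Implicit Types (A B : quaternion R) (e : 'rV[R]_3).

(** The symmetric bilinear form polarizing A |-> A e A*. *)
Definition hodo_form e A B : 'rV[R]_3 := vect (A * pure e * quat_conj B).

Lemma hodo_formC e A B : hodo_form e A B = hodo_form e B A.
Proof.
rewrite /hodo_form.
have -> : A * pure e * quat_conj B = - quat_conj (B * pure e * quat_conj A).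
  by rewrite !quat_conjM quat_conjK quat_conj_pure mulNr mulrN opprK mulrA.
by rewrite /quat_conj /vect /= opprK.
Qed.

Lemma hodo_form_pure e A : A * pure e * quat_conj A = pure (hodo_form e A A).
Proof.
set X := _ * _.
have : quat_conj X = - X.
  by rewrite /X !quat_conjM quat_conjK quat_conj_pure mulNr mulrN mulrA.
rewrite /hodo_form -/X; case: X => a u [] => h; congr pair.
lra.
Qed.

Lemma hodo_formDl e A A' B :
  hodo_form e (A + A') B = hodo_form e A B + hodo_form e A' B.
Proof. by rewrite /hodo_form !mulrDl. Qed.

Lemma hodo_formZl e l A B : hodo_form e (l *: A) B = l *: hodo_form e A B.
Proof. by rewrite /hodo_form -!scalerAl. Qed.

Lemma hodo_formDr e A A' B :
  hodo_form e B (A + A') = hodo_form e B A + hodo_form e B A'.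
Proof. by rewrite hodo_formC hodo_formDl !(hodo_formC e B). Qed.

Lemma hodo_formZr e l A B : hodo_form e B (l *: A) = l *: hodo_form e B A.
Proof. by rewrite hodo_formC hodo_formZl (hodo_formC e B). Qed.

(** The product of the quadratic Bernstein polynomials i and j is the quartic
    one i + j with the factor 1 for {0, 0} and {2, 2}, 1/2 for {0, 1} and {1, 2},
    1/6 for {0, 2} and 2/3 for {1, 1}.  By symmetry of the form, the factors of
    mixed pairs count twice. *)
Definition hodo_points e A0 A1 A2 : 'I_5 -> 'rV[R]_3 :=
  tnth [tuple hodo_form e A0 A0; hodo_form e A0 A1;
     3^-1 *: hodo_form e A2 A0 + (2 / 3) *: hodo_form e A1 A1;
     hodo_form e A2 A1; hodo_form e A2 A2].

Lemma hodo_points_preimage e A0 A1 A2 t :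
  hodo_form e (preimage_poly A0 A1 A2 t) (preimage_poly A0 A1 A2 t)
  = \sum_(i < 5) bernstein 4 i t *: hodo_points e A0 A1 A2 i.
Proof.
rewrite bernstein4_sum /hodo_points !(tnth_nth 0) /= !inordK//=.
rewrite /preimage_poly.
have -> : bernstein 2 0 t = (1 - t) ^+ 2 by rewrite /bernstein expr0 !mul1r.
have -> : bernstein 2 1 t = 2 * t * (1 - t) by rewrite /bernstein.
have -> : bernstein 2 2 t = t ^+ 2 by rewrite /bernstein expr0 mulr1 mul1r.
rewrite !(hodo_formDl, hodo_formDr, hodo_formZl, hodo_formZr).
rewrite (hodo_formC e A1 A0) (hodo_formC e A0 A2) (hodo_formC e A1 A2).
move: (hodo_form _ _ _) (hodo_form e A0 A1) (hodo_form e A2 A0)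
  (hodo_form e A1 A1) (hodo_form e A2 A1) (hodo_form e A2 A2).
clear; move=> u0 u1 u2 u3 u4 u5; by coords; congr row3; field.
Qed.

Lemma RRMF5_I_points e r : RRMF5_I e r <-> exists A0 A1 A2,
  hodo_form e A1 A1 = hodo_form e A2 A0 /\
  hodograph_control_points r (hodo_points e A0 A1 A2).
Proof.
split=> -[A0 [A1 [A2 [h1 h2]]]]; exists A0, A1, A2; split.
- by move: h1 => [].
- move=> t /h2; rewrite -hodo_points_preimage; cbv zeta.
  by rewrite -[quat_mul _ _]/(_ * pure e * quat_conj _) hodo_form_pure => -[].
- by rewrite -[quat_mul _ _]/(_ * pure e * quat_conj _) hodo_form_pure h1.
- move=> t /h2 ->; cbv zeta; rewrite -hodo_points_preimage.
  by rewrite -[RHS]/(_ * pure e * quat_conj _) hodo_form_pure.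
Qed.

Lemma hodograph_with_points (h : 'I_5 -> 'rV[R]_3) :
  exists r, hodograph_control_points r h.
Proof.
pose P k : {poly R} := \sum_(i < 5) (h i 0 k) *: bernstein_poly R 4 i.
exists (\row_k sval (cid (antiderivative (P k)))) => t _.
apply/rowP => k; rewrite !mxE; case: cid => Q /= ->.
rewrite /P horner_sum summxE; apply: eq_bigr => i _.
by rewrite hornerZ horner_bernstein_poly mxE mulrC.
Qed.

End Hodograph.

Section LiftCircle.
Variable R : realType.

Lemma qnorm_lift_gt0 (u w x : 'rV[R]_3) : x != 0 -> 0 < qnorm (lift_quat u w x).
Proof. by move=> x0; rewrite qnorm_gt0; apply: contra_neq x0 => -[]. Qed.

Lemma lift_quat_base (u w : 'rV[R]_3) :
  lift_quat u w (circle_base u w) = pure (circle_base u w).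
Proof.
rewrite /lift_quat /pure; congr pair; rewrite /circle_base /normalize dotvZl.
have -> : dotv (u + w) (crossv u w) = 0 by vector_ring.
by rewrite mulr0 oppr0 mul0r.
Qed.

(** Right multiplication by w is the complex structure of the plane of lifts; it
    takes the lift of the base point to a negative multiple of the lift of
    the direction. *)
Lemma lift_quat_dir (u w : 'rV[R]_3) :
  dotv u u = 1 -> dotv w w = 1 -> crossv u w != 0 ->
  lift_quat u w (circle_dir u w) =
  - (enorm (u + w) / enorm (crossv u w)) *: (pure (circle_base u w) * pure w).
Proof.
move=> uu ww uw; have b0 := addv_neq0 uw.
have N0 : enorm (u + w) != 0 by rewrite gt_eqF// enorm_gt0.
have L0 : enorm (crossv u w) != 0 by rewrite gt_eqF// enorm_gt0.
have nuw := neq_of_crossv uw.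
have bE : pure u * pure (circle_base u w) = pure (circle_base u w) * pure w.
  rewrite -lift_quat_base; apply: lift_quat_intertwines => //.
  rewrite /circle_base /normalize !dotvZl !dotvDl uu ww (dotvC w u); ring.
set X := pure (circle_base u w) * pure w.
have XE : X = lift_quat u w X.2.
  by apply: (lift_quat_unique uu ww nuw _).1; rewrite /X mulrA bE.
have X2 : X.2 = (enorm (u + w))^-1 *: crossv u w.
  rewrite /X /pure quat_mulE /= !scale0r !add0r /circle_base /normalize.
  by move: (enorm _)^-1 => k; clear; vector_ring.
rewrite XE X2 -lift_quatZ; congr lift_quat.
by rewrite scalerA mulNr mulrAC divff// mul1r scaleNr.
Qed.

End LiftCircle.

(** * The correspondence between the two circles *)

Section Transfer.
Variable R : realType.
Variables (s0 s2 s4 : 'rV[R]_3).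
Hypotheses (ss0 : dotv s0 s0 = 1) (ss2 : dotv s2 s2 = 1)
  (ss4 : dotv s4 s4 = 1) (s04 : s0 <> s4) (s2m : dotv s2 s0 = dotv s2 s4).

Let neg_unit (u : 'rV[R]_3) : dotv u u = 1 -> dotv (- u) (- u) = 1.
Proof. by rewrite dotvNl dotvNr opprK. Qed.

(** If s2 were parallel to s0 or s4, its equal products with them would force
    s0 = s4. *)
Lemma mid_not_parallel : crossv s0 s2 != 0 /\ crossv s4 s2 != 0.
Proof.
suff c1 : 1 - dotv s2 s0 ^+ 2 != 0.
  rewrite -!dotvv_eq0 !dotv_crossvv ss0 ss2 ss4 mulr1.
  by rewrite (dotvC s4) -s2m (dotvC s0) c1.
rewrite subr_eq0 eq_sym sqrf_eq1; apply/negP => /orP[] /eqP c.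
  apply: s04; rewrite -(unit_dot1 ss2 ss0 c); apply: unit_dot1 => //.
  by rewrite -s2m.
apply: s04; rewrite -(unit_dot1 (neg_unit ss2) ss0 _) ?dotvNl ?c ?opprK//.
by apply: unit_dot1; rewrite ?neg_unit// dotvNl -s2m c opprK.
Qed.

Let s02 : s0 <> s2. Proof. exact: (neq_of_crossv mid_not_parallel.1). Qed.
Let s42 : s4 <> s2. Proof. exact: (neq_of_crossv mid_not_parallel.2). Qed.

(** The quaternion Q with Y = Q X up to a positive factor: from
    A0 e A0* = |A0| ^ 2 s0 one gets Z s0 X = - |A0| ^ 2 Y, and Z is a positive
    multiple of the lift of s2. *)
Definition transfer_quat : quaternion R := - (lift_quat s4 s0 s2 * pure s0).

Lemma transfer_quat_intertwines :
  pure s4 * transfer_quat = transfer_quat * pure s0.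
Proof.
rewrite /transfer_quat mulrN mulNr mulrA lift_quat_intertwines//.
exact/nesym.
Qed.

Lemma qnorm_transfer_quat_gt0 : 0 < qnorm transfer_quat.
Proof.
rewrite /transfer_quat -scaleN1r qnormZ qnormM qnorm_pure ss0 sqrrN expr1n.
rewrite mul1r mulr1.
by apply: qnorm_lift_gt0; apply: sphere2_neq0; exact/sphere2E.
Qed.

(** Left multiplication by Q commutes with right multiplication by s2, so it is
    determined by its value on the lift of the base point.  The circles have the
    same factor m in [lift_quat_dir] because s0 . s2 = s4 . s2; hence K = m ^ 2.
    The determinant is positive because Q is invertible. *)
Lemma transfer_frame : exists K p q, 0 < p ^+ 2 + K * q ^+ 2 /\
  forall x, dotv x s0 = dotv x s2 ->
  (transfer_quat * lift_quat s0 s2 x).2 =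
  frame_map (circle_base s0 s2) (circle_dir s0 s2)
     (circle_base s4 s2) (circle_dir s4 s2) K p q x.
Proof.
have [x02 x42] := mid_not_parallel.
have hs0 : sphere2 s0 by exact/sphere2E.
have hs2 : sphere2 s2 by exact/sphere2E.
have hs4 : sphere2 s4 by exact/sphere2E.
have bd := circle_orthonormal x02; have bd' := circle_orthonormal x42.
have liftd := lift_quat_dir ss0 ss2 x02.
have liftd' := lift_quat_dir ss4 ss2 x42.
have liftb := lift_quat_base s0 s2; have liftb' := lift_quat_base s4 s2.
have eN : enorm (s4 + s2) = enorm (s0 + s2).
  by rewrite /enorm !dotvDl !dotvDr ss0 ss2 ss4 -s2m !(dotvC _ s2) -s2m.
have eL : enorm (crossv s4 s2) = enorm (crossv s0 s2).
  by rewrite /enorm !dotv_crossvv ss0 ss2 ss4 !(dotvC _ s2) -s2m.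
rewrite eN eL in liftd'.
set m := enorm _ / _ in liftd liftd'.
have m0 : 0 < m by rewrite divr_gt0// enorm_gt0// addv_neq0.
move: (fun x => circle_normal x hs0 hs2 x02).
move: (fun x => circle_normal x hs4 hs2 x42).
move: liftb liftb' liftd liftd' bd bd'; clearbody m.
move: (circle_base s0 s2) (circle_dir s0 s2).
move: (circle_base s4 s2) (circle_dir s4 s2).
move=> b' d' b d liftb liftb' liftd liftd' bd bd' normb' normb.
pose Y := transfer_quat * pure b.
have bs : pure s0 * pure b = pure b * pure s2.
  rewrite -liftb; apply: lift_quat_intertwines => //.
  apply/normb; vector_ring.
have [YE Yp] : Y = lift_quat s4 s2 Y.2 /\ dotv Y.2 s4 = dotv Y.2 s2.
  apply: lift_quat_unique => //.
  by rewrite /Y mulrA transfer_quat_intertwines -!mulrA bs.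
have Y2 := orthonormal_expand bd' ((normb' _).1 Yp).
set p := dotv _ b' in Y2; set q := dotv _ d' in Y2.
have YE' : Y = p *: pure b' - (q * m) *: (pure b' * pure s2).
  by rewrite YE Y2 lift_quatD !lift_quatZ liftb' liftd' scalerA mulrN scaleNr.
have Yd : transfer_quat * lift_quat s0 s2 d
  = p *: lift_quat s4 s2 d' - (m ^+ 2 * q) *: pure b'.
  rewrite liftd -scalerAr mulrA -/Y YE' mulrBl -!scalerAl -mulrA pure_sqr//.
  rewrite mulrN1 liftd' scalerN opprK scalerDr !scalerA -scaleNr.
  by congr (_ *: _ + _ *: _); rewrite /GRing.scale/=; ring.
exists (m ^+ 2), p, q; split.
  have Y0 : 0 < qnorm Y.
    rewrite qnormM mulr_gt0 ?qnorm_transfer_quat_gt0// qnorm_pure.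
    by case: bd => ->.
  have pp : 0 <= p ^+ 2 := sqr_ge0 p.
  have qq : 0 <= m ^+ 2 * q ^+ 2 by rewrite mulr_ge0 ?sqr_ge0.
  rewrite lt0r addr_ge0// andbT paddr_eq0//.
  rewrite sqrf_eq0 mulf_eq0 !sqrf_eq0 (gt_eqF m0)/=.
  apply/negP => /andP[/eqP p0 /eqP q0].
  by move: Y0; rewrite YE' p0 q0 mul0r !scale0r subr0 qnorm_gt0 eqxx.
move=> x xs; have xf := (normb x).1 xs.
rewrite {1}(orthonormal_expand bd xf) lift_quatD !lift_quatZ mulrDr -!scalerAr.
rewrite Yd liftb -/Y.
rewrite -[LHS]/(dotv x b *: Y.2 + dotv x d *: (p *: d' - (m ^+ 2 * q) *: b')).
rewrite Y2 /frame_map -/p -/q; move: (dotv x b) (dotv x d) (p) (q) (m ^+ 2).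
by clear; vector_ring.
Qed.

Variable e : 'rV[R]_3.
Hypothesis ee : dotv e e = 1.

Lemma transfer_of_RRMF5_I s1 s3 : RRMF5_I_pairs e s0 s2 s4 (s1, s3) ->
  [/\ great_circle s0 s2 s1, great_circle s4 s2 s3 &
  exists2 l, 0 < l & (transfer_quat * lift_quat s0 s2 s1).2 = l *: s3].
Proof.
move=> [/= hs1 hs3 [r [/RRMF5_I_points[A0 [A1 [A2 [cond hr]]]]]]].
move=> [h [hrh h0 hs]].
have E : h = hodo_points e A0 A1 A2.
  by apply: bernstein4_free => t ht; rewrite -hrh// hr.
have hE i : h i = enorm (h i) *: tnth [tuple s0; s1; s2; s3; s4] i.
  by rewrite hs; exact: normalizeE.
have hp i : 0 < enorm (h i) by rewrite enorm_gt0.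
move: (hE (inord 0)) (hE (inord 1)) (hE (inord 2)) (hE (inord 3)).
move: (hE (inord 4)).
move: (hp (inord 0)) (hp (inord 1)) (hp (inord 2)) (hp (inord 3)).
move: (hp (inord 4)).
move: (enorm _) (enorm _) (enorm _) (enorm _) (enorm _).
rewrite E /hodo_points !(tnth_nth 0) /= !inordK//= -cond -scalerDl.
have -> : 3^-1 + 2 / 3 = 1 :> R by field.
rewrite scale1r => n3 n2 n1 n0 n4 p4 p0 p1 p2 p3 e4 e0 e1 e2 e3.
split=> //.
have pureE A n s : hodo_form e A A = n *: s ->
    A * pure e * quat_conj A = pure (n *: s) by rewrite hodo_form_pure => ->.
have [q0 i0] := intertwines_rotation ee ss0 p0 (pureE _ _ _ e0).
have [q1 i1] := intertwines_rotation ee ss2 p2 (pureE _ _ _ e2).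
have [q2 i2] := intertwines_rotation ee ss4 p4 (pureE _ _ _ e4).
have j0 := conj_intertwines i0; have j1 := conj_intertwines i1.
pose X := A0 * pure e * quat_conj A1.
pose Y := A2 * pure e * quat_conj A1.
pose Z := A2 * pure e * quat_conj A0.
have XE : X = lift_quat s0 s2 X.2.
  apply: (lift_quat_unique ss0 ss2 s02 _).1.
  by rewrite /X -[RHS]mulrA j1 !mulrA i0.
have ZE : Z = lift_quat s4 s0 Z.2.
  apply: (lift_quat_unique ss4 ss0 (nesym s04) _).1.
  by rewrite /Z -[RHS]mulrA j0 !mulrA i2.
have YE : n0 *: Y = - (Z * pure s0) * X.
  rewrite /Z -(mulrA _ _ (pure s0)) j0 mulrA -(mulrA A2) pure_sqr// mulrN1.
  rewrite !mulNr opprK /X !mulrA -(mulrA A2) quat_conj_mul q0 -scalerAr mulr1.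
  by rewrite -!scalerAl.
have X2 : X.2 = n1 *: s1 by exact: e1.
have Y2 : Y.2 = n3 *: s3 by exact: e3.
have Z2 : Z.2 = n2 *: s2 by rewrite -e2 cond.
have YQ : n0 *: Y = (n1 * n2) *: (transfer_quat * lift_quat s0 s2 s1).
  rewrite YE ZE XE X2 Z2 !lift_quatZ /transfer_quat -!scalerAl -scalerAr.
  by rewrite !mulNr -!scalerAl !scalerN scalerA mulrC.
have nz : n1 * n2 != 0 by rewrite gt_eqF// mulr_gt0.
exists (n0 * n3 / (n1 * n2)); first by rewrite divr_gt0// mulr_gt0.
apply: (scalerI nz); rewrite [RHS]scalerA [X in X *: s3]mulrC divfK//.
by rewrite -scalerA -Y2; exact/esym/(congr1 snd YQ).
Qed.

Lemma RRMF5_I_of_transfer s1 s3 l :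
  great_circle s0 s2 s1 -> great_circle s4 s2 s3 -> 0 < l ->
  (transfer_quat * lift_quat s0 s2 s1).2 = l *: s3 ->
  RRMF5_I_pairs e s0 s2 s4 (s1, s3).
Proof.
move=> hs1 hs3 l0 lE.
pose X := lift_quat s0 s2 s1; pose Y := transfer_quat * X.
have [U [U1 sU]] := rotor_exists ee ss2.
have Xi : pure s0 * X = X * pure s2.
  by apply: lift_quat_intertwines => //; exact: hs1.2.
have Yi : pure s4 * Y = Y * pure s2.
  by rewrite /Y mulrA transfer_quat_intertwines -!mulrA Xi.
have X0 : 0 < qnorm X by rewrite qnorm_lift_gt0// (sphere2_neq0 hs1.1).
have Y0 : 0 < qnorm Y by rewrite qnormM mulr_gt0// qnorm_transfer_quat_gt0.
pose k := Num.sqrt (qnorm X).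
have k0 : 0 < k by rewrite sqrtr_gt0.
(* A1 rotates e to s2, and A0, A2 solve A0 e U* = X and A2 e U* = Y.  The
   length k of A1 makes A1 e A1* equal to the vector part of A2 e A0*, which is
   |X| ^ 2 s2. *)
pose A0 := - (X * U * pure e); pose A1 := k *: U.
pose A2 := - (Y * U * pure e).
have form V W : hodo_form e (- (V * U * pure e)) (- (W * U * pure e))
   = (V * pure s2 * quat_conj W).2.
  rewrite /hodo_form quat_conjN !quat_conjM quat_conj_pure.
  rewrite !(mulrN, mulNr) !opprK.
  rewrite -(mulrA _ (pure e) (pure e)) pure_sqr//.
  by rewrite !(mulrN, mulNr, mulrA, mulr1, opprK) -(mulrA V U) -sU mulrA
    -(mulrA _ U) quat_mul_conj U1 scale1r mulr1.
have form1 V : hodo_form e (- (V * U * pure e)) A1 = k *: V.2.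
  rewrite /hodo_form quat_conjZ -scalerAr mulNr -(mulrA _ (pure e)) pure_sqr//.
  by rewrite mulrN1 opprK -mulrA quat_mul_conj U1 scale1r mulr1.
have formX : hodo_form e A0 A0 = qnorm X *: s0.
  by rewrite form -Xi -mulrA quat_mul_conj -scalerAr mulr1.
have formY : hodo_form e A2 A2 = qnorm Y *: s4.
  by rewrite form -Yi -mulrA quat_mul_conj -scalerAr mulr1.
have formU : hodo_form e A1 A1 = qnorm X *: s2.
  rewrite hodo_formZl hodo_formZr scalerA -expr2 sqr_sqrtr ?ltW//.
  by rewrite /hodo_form (rotation_intertwines sU) U1 scale1r.
have formYX : hodo_form e A2 A0 = qnorm X *: s2.
  rewrite form /Y -(mulrA _ X) -Xi -!mulrA quat_mul_conj -!scalerAr mulr1.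
  by rewrite /transfer_quat mulNr -mulrA pure_sqr// mulrN1 opprK.
have [r hr] := hodograph_with_points (hodo_points e A0 A1 A2).
split=> //=; exists r; split.
  apply/RRMF5_I_points; exists A0, A1, A2.
  by split; [rewrite formU formYX|exact: hr].
exists (hodo_points e A0 A1 A2).
have H i : exists2 n, 0 < n &
    hodo_points e A0 A1 A2 i = n *: tnth [tuple s0; s1; s2; s3; s4] i.
  move: i; apply: ord5P; rewrite /hodo_points !(tnth_nth 0) /= !inordK//=.
  - by exists (qnorm X).
  - by exists k => //; rewrite form1.
  - exists (qnorm X) => //; rewrite formYX formU -scalerDl.
    by rewrite (_ : 3^-1 + 2 / 3 = 1) ?scale1r//; field.
  - by exists (k * l); rewrite ?mulr_gt0// form1 lE scalerA.
  - by exists (qnorm Y).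
have S i : sphere2 (tnth [tuple s0; s1; s2; s3; s4] i).
  move: i; apply: ord5P; rewrite !(tnth_nth 0) /= inordK//=; try exact/sphere2E.
    exact: hs1.1.
  exact: hs3.1.
split=> // i; have [n n0 ->] := H i.
  rewrite scaler_eq0 gt_eqF//= -dotvv_gt0.
  by have /sphere2E -> := S i.
by rewrite normalizeZ// normalize_id.
Qed.

End Transfer.

Unset Implicit Arguments.

Theorem proposition3p2 (R : realType) (e s0 s2 s4 : 'rV[R]_3)
    (he : enorm e = 1)
    (hs0 : sphere2 s0) (hs4 : sphere2 s4) (hs04 : s0 <> s4)
    (hs2 : great_circle s0 s4 s2) :
  (exists sigma1 sigma3 : R -> 'rV[R]_3,
    [/\ smooth_curve sigma1, smooth_curve sigma3,
        forall t, sigma1 (t + 2 * pi) = sigma1 t,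
        forall t, sigma3 (t + 2 * pi) = sigma3 t
      & set_bij [set` `[0, 2 * pi[] (RRMF5_I_pairs e s0 s2 s4)
          (fun t => (sigma1 t, sigma3 t))])
  /\ (forall s1, great_circle s0 s2 s1 ->
        exists! s3, RRMF5_I_pairs e s0 s2 s4 (s1, s3))
  /\ (forall s3, great_circle s4 s2 s3 ->
        exists! s1, RRMF5_I_pairs e s0 s2 s4 (s1, s3))
  /\ (exists phi psi : 'rV[R]_3 -> 'rV[R]_3,
        (forall s1 s3, RRMF5_I_pairs e s0 s2 s4 (s1, s3) <->
           great_circle s0 s2 s1 /\ s3 = phi s1)
        /\ (forall s1 s3, RRMF5_I_pairs e s0 s2 s4 (s1, s3) <->
           great_circle s4 s2 s3 /\ s1 = psi s3)
        /\ set_bij (great_circle s0 s2) (great_circle s4 s2) phi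
        /\ smooth_on_circle s0 s2 phi
        /\ smooth_on_circle s4 s2 psi
        /\ orientation_preserving s0 s2 s4 s2 phi).
Proof.
have ee : dotv e e = 1 by apply/sphere2E.
have [hs2' s2m] := hs2.
have ss0 := (sphere2E s0).1 hs0; have ss4 := (sphere2E s4).1 hs4.
have ss2 := (sphere2E s2).1 hs2'.
have [x02 x42] := mid_not_parallel ss0 ss2 ss4 hs04 s2m.
have bd := circle_orthonormal x02; have bd' := circle_orthonormal x42.
have [K [p [q [D0 F]]]] := transfer_frame ss0 ss2 ss4 hs04 s2m.
set b := circle_base s0 s2 in F bd; set d := circle_dir s0 s2 in F bd.
set b' := circle_base s4 s2 in F bd'; set d' := circle_dir s4 s2 in F bd'.
have D0' : 0 < p ^+ 2 + K * (- q) ^+ 2 by rewrite sqrrN.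
pose phi := circle_map b d b' d' K p q.
pose psi := circle_map b' d' b d K p (- q).
have C x : great_circle s0 s2 x <-> sphere2 x /\ dotv x (crossv b d) = 0.
  by split=> -[h1 h2]; split=> //; exact/(circle_normal x hs0 hs2' x02).
have C' x : great_circle s4 s2 x <-> sphere2 x /\ dotv x (crossv b' d') = 0.
  by split=> -[h1 h2]; split=> //; exact/(circle_normal x hs4 hs2' x42).
have phiC x : great_circle s0 s2 x -> great_circle s4 s2 (phi x).
  by move=> /C[h1 h2]; apply/C'; exact: circle_map_in.
have psiC x : great_circle s4 s2 x -> great_circle s0 s2 (psi x).
  by move=> /C'[h1 h2]; apply/C; exact: circle_map_in.
have phiK x : great_circle s0 s2 x -> psi (phi x) = x.
  by move=> /C[h1 h2]; exact: circle_mapK.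
have psiK x : great_circle s4 s2 x -> phi (psi x) = x.
  move=> /C'[h1 h2]; rewrite /phi -[q]opprK; exact: circle_mapK.
have pairs s1 s3 : RRMF5_I_pairs e s0 s2 s4 (s1, s3) <->
    great_circle s0 s2 s1 /\ s3 = phi s1.
  split.
    move=> /(transfer_of_RRMF5_I ss0 ss2 ss4 hs04 s2m ee)[h1 h3 [l l0]].
    rewrite F; last exact: h1.2.
    move=> E; split=> //.
    by rewrite /phi /circle_map E normalizeZ// normalize_id//; exact: h3.1.
  move=> [h1 ->]; have [h1s h1n] := (C _).1 h1.
  have F0 : frame_map b d b' d' K p q s1 != 0.
    by apply: frame_map_neq0 => //; exact: sphere2_neq0.
  apply: (@RRMF5_I_of_transfer _ s0 s2 s4 _ _ _ _ _ _ _ _ _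
    (enorm (frame_map b d b' d' K p q s1))) => //.
  - exact: phiC.
  - by rewrite enorm_gt0.
  - by rewrite F; [exact: normalizeE|exact: h1.2].
have pairs' s1 s3 : RRMF5_I_pairs e s0 s2 s4 (s1, s3) <->
    great_circle s4 s2 s3 /\ s1 = psi s3.
  rewrite pairs; split=> -[h ->]; split.
  - exact: phiC.
  - by rewrite phiK.
  - exact: psiC.
  - by rewrite psiK.
split; [|split; [|split]].
- exists (circle_param s0 s2), (phi \o circle_param s0 s2); split.
  + exact: smooth_frame_circle.
  + exact: smooth_circle_map.
  + by move=> t; exact: frame_circleD2pi.
  + by move=> t; congr phi; exact: frame_circleD2pi.
  + split.
    * by move=> t _; apply/pairs; split=> //; exact: circle_param_in.
    * move=> t s; rewrite !inE /= !in_itv /= => ht hs [E _].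
      exact: (frame_circle_inj bd).
    * move=> [s1 s3] /pairs[/great_circleP-/(_ hs0 hs2' x02)[t ht ->] ->].
      by exists t; rewrite //= in_itv.
- move=> s1 h1; exists (phi s1); split; first exact/pairs.
  by move=> s3 /pairs[_ ->].
- move=> s3 h3; exists (psi s3); split; first exact/pairs'.
  by move=> s1 /pairs'[_ ->].
- exists phi, psi; split; first exact: pairs.
  split; first exact: pairs'.
  split; [|split; [|split]].
  + split.
    * exact: phiC.
    * by move=> x y; rewrite !inE => /phiK {2}<- /phiK {2}<- ->.
    * by move=> y hy; exists (psi y); [exact: psiC|exact: psiK].
  + exact: smooth_circle_map.
  + exact: smooth_circle_map.
  + move=> t; have [c c0 E] := derive_circle_map bd bd' D0 t.
    by exists c.
Qed.
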